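(* Let $G$ be a graph that is a path $P_n$ (on $n$ vertices) not isomorphic to $K_2$, or a cycle $C_n$ with $n\ge 3$, or a wheel $W_n$ with $n\ge 4$. Then ${\rm lir}(^2G)\le 2$.
   Context: For a graph $G$, $^2G$ denotes the multigraph (2-multigraph) obtained from $G$ by replacing every edge by two parallel edges. The degree of a vertex in a multigraph counts parallel edges with multiplicity. A multigraph is locally irregular if any two adjacent vertices have distinct degrees. A locally irregular edge coloring of a multigraph $M$ is an assignment of colors to the individual edges of $M$ (the two parallel copies of an edge may receive different colors) such that, for each color, the submultigraph formed by the edges of that color is locally irregular. ${\rm lir}(M)$ is the smallest number of colors in a locally irregular edge coloring of $M$. The wheel $W_n$ is the graph of order $n$ consisting of a cycle of length $n-1$ together with a central vertex adjacent to all vertices of the cycle. *)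

(* Defs.v *)
From mathcomp Require Import all_boot.

Set Implicit Arguments.
Unset Strict Implicit.
Unset Printing Implicit Defensive.

Record graph := Graph {
  vertex :> finType;
  adj : rel vertex;
  adj_sym : symmetric adj;
  adj_irr : irreflexive adj }.

Definition graph_iso (G H : graph) : Prop :=
  exists2 f : G -> H, bijective f & forall x y, adj (f x) (f y) = adj x y.

Definition edges (G : graph) : {set {set G}} :=
  [set e : {set G} | [exists x, exists y, adj x y && (e == [set x; y])]].

(* Parallel edges are distinct elements of [medge] with the same endpoints;
   loops are excluded. *)
Record multigraph := Multigraph {
  mvertex : finType;
  medge : finType;
  ends : medge -> {set mvertex};
  ends2 : forall e, #|ends e| = 2 }.

Definition mdeg (M : multigraph) (v : mvertex M) : nat :=
  #|[set e : medge M | v \in ends e]|.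

Definition madj (M : multigraph) (u v : mvertex M) : bool :=
  [exists e : medge M, ends e == [set u; v]].

Definition locally_irregular (M : multigraph) : bool :=
  [forall u : mvertex M, forall v : mvertex M,
     madj u v ==> (mdeg u != mdeg v)].

(* All vertices are kept; isolated ones have no effect on local irregularity. *)
Definition edge_submultigraph (M : multigraph) (A : {set medge M}) :
    multigraph :=
  @Multigraph (mvertex M) {e : medge M | e \in A}
    (fun e => ends (val e)) (fun e => ends2 (val e)).

Definition li_coloring (M : multigraph) (k : nat)
    (c : {ffun medge M -> 'I_k}) : bool :=
  [forall i : 'I_k,
     locally_irregular (edge_submultigraph [set e | c e == i])].

Definition li_colorable (M : multigraph) (k : nat) : bool :=
  [exists c : {ffun medge M -> 'I_k}, li_coloring c].

(* The relation lir(M) = k; no such k exists when M has no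
   locally irregular edge coloring. *)
Definition is_lir (M : multigraph) (k : nat) : Prop :=
  li_colorable M k /\ forall j, li_colorable M j -> k <= j.

Lemma card_edge (G : graph) (e : {set G}) : e \in edges G -> #|e| = 2.
Proof.
rewrite inE => /existsP[x /existsP[y /andP[xy /eqP->]]].
by rewrite cards2; case: eqP xy => // ->; rewrite adj_irr.
Qed.

Definition two_multigraph (G : graph) : multigraph :=
  @Multigraph G ({e : {set G} | e \in edges G} * bool)%type
    (fun e => val e.1) (fun e => card_edge (valP e.1)).

Definition complete_rel (n : nat) : rel 'I_n := fun i j => i != j.

Lemma complete_rel_sym n : symmetric (@complete_rel n).
Proof. by move=> i j; rewrite /complete_rel eq_sym. Qed.

Lemma complete_rel_irr n : irreflexive (@complete_rel n).
Proof. by move=> i; rewrite /complete_rel eqxx. Qed.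

Definition complete_graph (n : nat) : graph :=
  Graph (@complete_rel_sym n) (@complete_rel_irr n).

Definition path_rel (n : nat) : rel 'I_n :=
  fun i j => (i.+1 == j :> nat) || (j.+1 == i :> nat).

Lemma path_rel_sym n : symmetric (@path_rel n).
Proof. by move=> i j; rewrite /path_rel orbC. Qed.

Lemma path_rel_irr n : irreflexive (@path_rel n).
Proof. by move=> i; rewrite /path_rel orbb gtn_eqF. Qed.

Definition path_graph (n : nat) : graph :=
  Graph (@path_rel_sym n) (@path_rel_irr n).

(* The condition [i != j] only matters for n = 1. *)
Definition cycle_rel (n : nat) : rel 'I_n :=
  fun i j => (i != j) && ((i.+1 %% n == j :> nat) || (j.+1 %% n == i :> nat)).

Lemma cycle_rel_sym n : symmetric (@cycle_rel n).
Proof. by move=> i j; rewrite /cycle_rel eq_sym orbC. Qed.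

Lemma cycle_rel_irr n : irreflexive (@cycle_rel n).
Proof. by move=> i; rewrite /cycle_rel eqxx. Qed.

Definition cycle_graph (n : nat) : graph :=
  Graph (@cycle_rel_sym n) (@cycle_rel_irr n).

(* [None] is the central vertex, so that the wheel W_n has n vertices. *)
Definition wheel_rel (n : nat) : rel (option 'I_n.-1) :=
  fun u v => match u, v with
             | Some i, Some j => cycle_rel i j
             | None, None => false
             | _, _ => true
             end.

Lemma wheel_rel_sym n : symmetric (@wheel_rel n).
Proof. by move=> [i|] [j|] //=; rewrite cycle_rel_sym. Qed.

Lemma wheel_rel_irr n : irreflexive (@wheel_rel n).
Proof. by move=> [i|] //=; rewrite cycle_rel_irr. Qed.

Definition wheel_graph (n : nat) : graph :=
  Graph (@wheel_rel_sym n) (@wheel_rel_irr n).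

(* Main.v *)
Require Import Defs.
From mathcomp Require Import all_boot.
From mathcomp Require Import zify.

(* Colouring the two copies of each edge red or blue amounts to choosing the
   number w(e) in {0,1,2} of red copies. On a path or a cycle with consecutive
   edges e_1, e_2, ..., the red degrees of the two ends of e_i are
   w(e_(i-1)) + w(e_i) and w(e_i) + w(e_(i+1)), and the blue ones are their
   complements to 4, so away from the ends of a path it is enough that
   w(e_(i-1)) <> w(e_(i+1)). On a wheel, colour the rim as the cycle and all
   spokes red: this raises all rim degrees by 2, and the red degree of the hub
   is too large to be attained on the rim. *)

Set Implicit Arguments.
Unset Strict Implicit.
Unset Printing Implicit Defensive.

(** * From weights on the edges of a graph to 2-colourings of its doubled multigraph *)

Lemma in_edges2 (G : graph) (x y : G) : ([set x; y] \in edges G) = adj x y.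
Proof.
apply/idP/idP=> [xyE|xy]; last first.
  by rewrite inE; apply/existsP; exists x; apply/existsP; exists y; rewrite xy /=.
have := xyE; rewrite inE => /existsP[x' /existsP[y' /andP[xy' /eqP E]]].
have := card_edge xyE; rewrite cards2; have [//|xNy _] := eqVneq x y.
have: x \in [set x'; y'] by rewrite -E set21.
have: y \in [set x'; y'] by rewrite -E set22.
move=> /set2P[] ey /set2P[] ex; move: xNy; rewrite ex ey ?eqxx //.
by rewrite adj_sym.
Qed.

(* [w x y] is the number of red copies of the edge xy. *)
Record li_weighting (G : graph) (w : G -> G -> nat) : Prop := LiWeighting {
  liw_sym : forall x y, adj x y -> w x y = w y x;
  liw_le2 : forall x y, w x y <= 2;
  liw_red : forall x y, adj x y -> 0 < w x y ->
    \sum_(z | adj x z) w x z <> \sum_(z | adj y z) w y z;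
  liw_blue : forall x y, adj x y -> w x y < 2 ->
    \sum_(z | adj x z) (2 - w x z) <> \sum_(z | adj y z) (2 - w y z) }.

(** Degrees in a colour class become sums over neighbours: [h] and [k] inject the selected edges at
    [v] and the pairs (neighbour, copy) into the same set of pairs (endpoint set, copy). The
    selection [C] acts on bare sets, so it can be evaluated at [[set v; u]] without a proof that
    this is an edge. *)
Lemma mdeg_edge_submultigraph (G : graph) (C : {set G} -> bool -> bool)
    (A : {set medge (two_multigraph G)}) (v : G) :
    (forall e, (e \in A) = C (val e.1) e.2) ->
  mdeg (v : mvertex (edge_submultigraph A)) =
    \sum_(u | adj v u) (C [set v; u] true + C [set v; u] false).
Proof.
move=> AC; pose h (e : medge (edge_submultigraph A)) := (val (val e).1, (val e).2).
pose k (p : G * bool) := ([set v; p.1], p.2).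
have h_inj : injective h.
  move=> [[s b] sA] [[t d] tA] /= [] /val_inj est ebd.
  by apply: val_inj; rewrite /= est ebd.
have k_inj : injective k.
  move=> [x b] [y d] [] /setP exy ->; congr pair.
  have /set2P[xv|//] : x \in [set v; y] by rewrite -exy set22.
  have : y \in [set v; x] by rewrite exy set22.
  by rewrite xv !inE orbb => /eqP.
rewrite /mdeg -(card_imset _ h_inj).
have -> : [set h e | e in [set e : medge (edge_submultigraph A) | v \in ends e]] =
    [set k p | p in [set p : G * bool | adj v p.1 && C [set v; p.1] p.2]].
  apply/setP=> -[s b]; apply/imsetP/imsetP.
  - case=> -[[[t tE] d] eA]; rewrite inE /= => vt [-> ->].
    have := eA; rewrite AC /= => Ct.
    have := tE; rewrite inE => /existsP[x /existsP[y /andP[xy /eqP te]]].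
    move: vt; rewrite te => /set2P[] vE.
      by exists (y, d); rewrite /k ?inE /= vE -te ?xy.
    by exists (x, d); rewrite /k ?inE /= vE [[set y; x]]setUC -te // adj_sym xy.
  case=> -[u d]; rewrite inE /= => /andP[vu Cd] [-> ->].
  have sE : [set v; u] \in edges G by rewrite in_edges2.
  pose e : medge (two_multigraph G) := (exist (fun s => s \in edges G) _ sE, d).
  have eA : e \in A by rewrite AC.
  by exists (exist (fun e => e \in A) e eA) => //; rewrite inE /= set21.
rewrite card_imset // -sum1dep_card -(pair_big_dep _ (fun u b => C [set v; u] b) (fun _ _ => 1)) /=.
apply: eq_bigr => u _; rewrite big_mkcond big_bool /=.
by do 2 case: (C _ _).
Qed.

Lemma li_weighting_colorable (G : graph) (w : G -> G -> nat) :
  li_weighting w -> li_colorable (two_multigraph G) 2.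
Proof.
case=> w_sym w_le2 w_red w_blue.
(* Copy [b] is red when [b < w x y], reading [false] as 0 and [true] as 1, so exactly [w x y] copies
   are red. Quantifying over both orders of the endpoints makes this a function of the unordered
   edge. *)
pose C (s : {set G}) (b : bool) :=
  [exists x in s, exists y in s, adj x y && (b < w x y)].
have CE x y b : adj x y -> C [set x; y] b = (b < w x y).
  move=> xy; apply/idP/idP=> [|bw].
    case/exists_inP=> x' x'P /exists_inP[y' y'P] /andP[].
    by case/set2P: x'P => ->; case/set2P: y'P => ->;
      rewrite ?adj_irr // w_sym // adj_sym.
  apply/exists_inP; exists x; first exact: set21.
  by apply/exists_inP; exists y; rewrite ?set22 // xy.
pose c : {ffun medge (two_multigraph G) -> 'I_2} :=
  [ffun e => if C (val e.1) e.2 then ord0 else ord_max].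
have deg0 (v : G) :
    mdeg (v : mvertex (edge_submultigraph [set e | c e == ord0])) =
    \sum_(u | adj v u) w v u.
  rewrite (@mdeg_edge_submultigraph _ C) => [|e].
    apply: eq_bigr => u vu; rewrite !CE //.
    by have := w_le2 v u; case: (w v u) => [|[|[|]]].
  by rewrite inE ffunE; case: (C _ _).
have deg1 (v : G) :
    mdeg (v : mvertex (edge_submultigraph [set e | c e == ord_max])) =
    \sum_(u | adj v u) (2 - w v u).
  rewrite (@mdeg_edge_submultigraph _ (fun s b => ~~ C s b)) => [|e].
    apply: eq_bigr => u vu; rewrite !CE //.
    by have := w_le2 v u; case: (w v u) => [|[|[|]]].
  by rewrite inE ffunE; case: (C _ _).
apply/existsP; exists c; apply/forallP=> i.
have {i}[->|->] : i = ord0 \/ i = ord_max.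
  by case: i => -[|[|//]] ?; [left|right]; apply: val_inj.
all: apply/forallP=> x; apply/forallP=> y; apply/implyP.
all: case/existsP=> -[[[s sE] b] eA] /= /eqP sxy.
all: have xy : adj (x : G) y by rewrite -in_edges2 -sxy.
all: apply/eqP; move: eA; rewrite inE ffunE /= sxy CE //.
  by case: ifP => // bw _; rewrite !deg0; apply: w_red => //; apply: leq_ltn_trans bw.
case: ifP => // /negbT; rewrite -leqNgt => bw _.
by rewrite !deg1; apply: w_blue => //; apply: leq_ltn_trans bw _; case: (b).
Qed.

Lemma li_weighting_iso (G H : graph) (w : H -> H -> nat) :
  graph_iso G H -> li_weighting w -> exists w', @li_weighting G w'.
Proof.
case=> f f_bij f_adj [w_sym w_le2 w_red w_blue].
have sumE (F : H -> H -> nat) x :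
    \sum_(z | adj x z) F (f x) (f z) = \sum_(z | adj (f x) z) F (f x) z.
  rewrite [RHS](reindex f) /=; first by apply: eq_bigl => z; rewrite f_adj.
  exact: onW_bij.
exists (fun x y => w (f x) (f y)); split=> [x y xy|x y|x y xy wxy|x y xy wxy].
- by apply: w_sym; rewrite f_adj.
- exact: w_le2.
- by rewrite !(sumE w); apply: w_red; rewrite ?f_adj.
- by rewrite !(sumE (fun x z => 2 - w x z)); apply: w_blue; rewrite ?f_adj.
Qed.

Lemma li_colorable_is_lir (M : multigraph) (n : nat) :
  li_colorable M n -> exists k, is_lir M k /\ k <= n.
Proof.
move=> Mn; have exM : exists k, li_colorable M k by exists n.
by case: (ex_minnP exM) => k Mk k_min; exists k; split; [split | apply: k_min].
Qed.

(** * Paths *)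

(* The pattern 2,2,0,0,2,2,0,0,..., whose end is changed to 2,1,0 or to
   2,2,1,0,0 when [m] is 3 or 1 modulo 4. *)
Definition path_weight (m i : nat) : nat :=
  if (m %% 4 == 3) && (i + 2 == m) || (m %% 4 == 1) && (i + 3 == m) then 1
  else if (i %% 4 < 2) && ~~ ((m %% 4 == 1) && (i + 1 == m)) then 2 else 0.

Lemma sum_path_rel n (v : 'I_n) (F : nat -> nat) :
  \sum_(u | path_rel v u) F u =
    (if 0 < v then F v.-1 else 0) + (if v.+1 < n then F v.+1 else 0).
Proof.
rewrite (bigID (fun u : 'I_n => u < v)) /=; congr (_ + _).
  case: ifP => v0; last by rewrite big1 // => u; rewrite /path_rel; lia.
  have un : v.-1 < n by have := ltn_ord v; lia.
  rewrite (big_pred1 (Ordinal un)) // => u.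
  by rewrite /= -(inj_eq val_inj) /path_rel /=; lia.
case: ifP => vn.
  rewrite (big_pred1 (Ordinal vn)) // => u.
  by rewrite /= -(inj_eq val_inj) /path_rel /=; lia.
by rewrite big1 // => u; rewrite /path_rel; have := ltn_ord u; lia.
Qed.

Lemma path_weight_le2 m i : path_weight m i <= 2.
Proof. by rewrite /path_weight; do ?case: ifP. Qed.

Lemma path_weight_step m i : i.+2 < m -> path_weight m i <> path_weight m i.+2.
Proof. rewrite /path_weight; do ?case: ifP; lia. Qed.

(** An end vertex of the path lies on a single edge. The red degrees on the first edge thus differ
    by the weight of the second edge, and the blue ones by 2 minus that weight. The next lemma
    treats the last edge likewise. *)
Lemma path_weight_start m : 1 < m ->
  (0 < path_weight m 0 -> path_weight m 1 <> 0) /\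
  (path_weight m 0 < 2 -> path_weight m 1 <> 2).
Proof. rewrite /path_weight; do ?case: ifP; lia. Qed.

Lemma path_weight_end k :
  (0 < path_weight k.+2 k.+1 -> path_weight k.+2 k <> 0) /\
  (path_weight k.+2 k.+1 < 2 -> path_weight k.+2 k <> 2).
Proof. rewrite /path_weight; do ?case: ifP; lia. Qed.

Lemma path_li_weighting n : n != 2 ->
  li_weighting (fun i j : path_graph n => path_weight n.-1 (minn i j)).
Proof.
move=> n2.
have sumE (F : nat -> nat) (v : path_graph n) :
    \sum_(u | adj v u) F (minn v u) =
    (if 0 < v then F v.-1 else 0) + (if v.+1 < n then F v else 0).
  rewrite (sum_path_rel v (fun u => F (minn v u))).
  by congr (_ + _); case: ifP => // _; congr F; lia.
(* Stated for a general [F] to serve both colours: [F] is the weight for red and 2 minus the weight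
   for blue. The edge between [i] and [i.+1] has number [i], whence [minn]. *)
have neq (F : nat -> nat) (x y : 'I_n) : (forall i, i.+2 < n.-1 -> F i <> F i.+2) ->
    (1 < n.-1 -> 0 < F 0 -> F 1 <> 0) ->
    (forall k, n.-1 = k.+2 -> 0 < F k.+1 -> F k <> 0) ->
    path_rel x y -> 0 < F (minn x y) ->
    \sum_(u | path_rel x u) F (minn x u) <> \sum_(u | path_rel y u) F (minn y u).
  move=> step start stop.
  wlog xy : x y / x.+1 = y.
    move=> base xy; have /orP[/eqP|/eqP yx] := xy; first by move/base; apply.
    by rewrite minnC => Fxy /esym; apply: base Fxy; rewrite // path_rel_sym.
  rewrite !sumE -xy /= => _; have -> : minn x x.+1 = x by lia.
  have yn := ltn_ord y; rewrite -xy in yn; rewrite yn => Fx.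
  (* The common term [F x] cancels, leaving the edges before and after. If both are absent then [n]
     is 2, which is excluded. *)
  case: (posnP x) Fx => [x0 | x0] Fx.
    rewrite x0 in Fx *; case: ifP => n3 /=; last lia.
    have n1 : 1 < n.-1 by lia.
    by have := start n1 Fx; lia.
  case: ifP => nx; first by have := step x.-1; rewrite prednK //; lia.
  by have := stop x.-1; rewrite prednK //; lia.
split=> [x y _|x y|x y xy Fxy|x y xy Fxy].
- by rewrite minnC.
- exact: path_weight_le2.
- apply: (neq (path_weight n.-1)) => //.
  + exact: path_weight_step.
  + by case/path_weight_start.
  + by move=> k ->; case: (path_weight_end k).
- apply: (neq (fun i => 2 - path_weight n.-1 i)) => //; last lia.
  + move=> i /path_weight_step.
    by have := path_weight_le2 n.-1 i; have := path_weight_le2 n.-1 i.+2; lia.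
  + by case/path_weight_start; have := path_weight_le2 n.-1 1; lia.
  + by move=> k ->; case: (path_weight_end k); have := path_weight_le2 k.+2 k; lia.
Qed.

(** * Cycles *)

(* The pattern 2,2,0,0,2,2,0,0,..., with a 1 put where two terms at distance
   two would agree across the end of the cycle. *)
Definition cycle_pattern (n i : nat) : nat :=
  if (n %% 4 == 1) && (i + 1 == n) || (n %% 4 == 2) && (n <= i + 2)
     || (n %% 4 == 3) && (i + 2 == n) then 1
  else if i %% 4 < 2 then 2 else 0.

Lemma cycle_pattern_le2 n i : cycle_pattern n i <= 2.
Proof. by rewrite /cycle_pattern; do ?case: ifP. Qed.

Lemma val_ordS n (i : 'I_n) : ordS i = (if i.+1 == n then 0 else i.+1) :> nat.
Proof.
by case: eqP => [/= ->|ne]; rewrite ?modnn //= modn_small //; have := ltn_ord i; lia.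
Qed.

Lemma val_ord_pred n (i : 'I_n) :
  ord_pred i = (if i == 0 :> nat then n.-1 else i.-1) :> nat.
Proof.
have := ltn_ord i; case: eqP => [/= ->|ne] i_lt /=; first by rewrite add0n modn_small; lia.
have -> : (i + n).-1 = i.-1 + n by lia.
by rewrite modnDr modn_small; lia.
Qed.

Lemma cycle_pattern_neq n (i : 'I_n) : 2 < n ->
  cycle_pattern n (ord_pred i) <> cycle_pattern n (ordS i).
Proof.
move=> n3; rewrite val_ordS val_ord_pred; have := ltn_ord i.
by do 2 case: ifP; rewrite /cycle_pattern; do ?case: ifP; lia.
Qed.

(** On a cycle of length at least 3 the two neighbours of a vertex are distinct, so that degrees
    split into two terms. *)
Lemma ordS_neq_pred n (i : 'I_n) : 2 < n -> ordS i != ord_pred i.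
Proof.
move=> n3; rewrite -(inj_eq (@ord_inj n)) val_ordS val_ord_pred.
by have := ltn_ord i; do ?case: ifP; lia.
Qed.

Lemma cycle_relE n (i j : 'I_n) : 2 < n ->
  cycle_rel i j = (j == ordS i) || (j == ord_pred i).
Proof.
move=> n3; rewrite /cycle_rel.
have -> : (i.+1 %% n == j) = (j == ordS i) by rewrite eq_sym.
have -> : (j.+1 %% n == i) = (j == ord_pred i).
  by rewrite -(inj_eq (@ordS_inj n)) ord_predK.
have [<-|//] := eqVneq i j; rewrite -!(inj_eq (@ord_inj n)) val_ordS val_ord_pred.
by apply/esym/negbTE; have := ltn_ord i; do ?case: ifP; lia.
Qed.

(** The edge from [i] to [ordS i] has number [i]. A neighbour [j] other than [ordS i] is
    [ord_pred i], and then the edge has number [j]. Taking [minn] would misnumber the edge that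
    closes the cycle. *)
Definition cycle_weight n (i j : 'I_n) : nat :=
  cycle_pattern n (if j == ordS i then i else j).

Lemma sum_cycle_weight n (F : nat -> nat) (i : 'I_n) : 2 < n ->
  \sum_(j | cycle_rel i j) F (cycle_weight i j) =
    F (cycle_pattern n i) + F (cycle_pattern n (ord_pred i)).
Proof.
move=> n3; have Sp := ordS_neq_pred i n3.
rewrite (bigD1 (ordS i)) ?cycle_relE ?eqxx //=; congr (_ + _).
  by rewrite /cycle_weight eqxx.
rewrite (big_pred1 (ord_pred i)) => [|j] /=.
  by rewrite /cycle_weight eq_sym (negbTE Sp).
by rewrite cycle_relE //; case: eqVneq => [->|] //=; rewrite ?andbT ?(negbTE Sp).
Qed.

Lemma cycle_weight_sym n (i j : 'I_n) : 2 < n ->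
  cycle_rel i j -> cycle_weight i j = cycle_weight j i.
Proof.
move=> n3; wlog: i j / j = ordS i.
  move=> base ij; have := ij; rewrite cycle_relE // => /orP[]/eqP ji.
    exact: base.
  by apply/esym/base; rewrite ?ji ?ord_predK // -ji cycle_rel_sym.
(* If [i] were [ordS (ordS i)], the successor and predecessor of [ordS i] would coincide. *)
move=> -> _; rewrite /cycle_weight eqxx; case: eqP => // /(congr1 (@ord_pred n)).
by rewrite ordSK => /eqP; rewrite eq_sym (negbTE (ordS_neq_pred _ n3)).
Qed.

(** The term of the edge itself cancels, leaving [F] at the two edges next to it, whose weights
    differ. Injectivity on 0, 1, 2 covers both [id] (red) and [subn 2] (blue). *)
Lemma sum_cycle_weight_neq n (F : nat -> nat) (i j : 'I_n) : 2 < n ->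
  {in [pred k | k <= 2] &, injective F} -> cycle_rel i j ->
  \sum_(k | cycle_rel i k) F (cycle_weight i k) <>
  \sum_(k | cycle_rel j k) F (cycle_weight j k).
Proof.
move=> n3 F_inj; wlog: i j / j = ordS i.
  move=> base ij; have := ij; rewrite cycle_relE // => /orP[]/eqP ji.
    exact: base.
  by apply/nesym/base; rewrite ?ji ?ord_predK // -ji cycle_rel_sym.
move=> -> _; rewrite !sum_cycle_weight // ordSK addnC => /addIn.
by move/F_inj; rewrite !inE !cycle_pattern_le2 => /(_ isT isT); apply: cycle_pattern_neq.
Qed.

Lemma cycle_li_weighting n : 2 < n ->
  li_weighting (fun i j : cycle_graph n => cycle_weight i j).
Proof.
move=> n3; split=> [x y|x y|x y xy _|x y xy _].
- exact: cycle_weight_sym.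
- exact: cycle_pattern_le2.
- exact: (sum_cycle_weight_neq (F := id)).
- apply: (sum_cycle_weight_neq (F := subn 2)) => // a b; rewrite !inE; lia.
Qed.

(** * Wheels *)

Definition wheel_weight n (u v : option 'I_n) : nat :=
  if u is Some i then if v is Some j then cycle_weight i j else 2 else 2.

Lemma big_option (T : finType) (P : pred (option T)) (F : option T -> nat) :
  \sum_(u | P u) F u = (if P None then F None else 0) + \sum_(i | P (Some i)) F (Some i).
Proof.
rewrite (bigID (pred1 None)) /=; congr (_ + _).
  case: ifP => PN; last by rewrite big1 // => u /andP[Pu /eqP uN]; rewrite -uN Pu in PN.
  by rewrite (big_pred1 None) // => u /=; case: eqP => [->|]; rewrite ?PN ?andbF.
rewrite (reindex_omap Some id) /=; last by case=> [i|]; rewrite ?andbF.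
by apply: eq_bigl => i; rewrite eqxx !andbT.
Qed.

Lemma wheel_li_weighting n : 3 < n ->
  li_weighting (fun u v : wheel_graph n => wheel_weight u v).
Proof.
move=> n4; have m3 : 2 < n.-1 by lia.
have rim (F : nat -> nat) (i : 'I_n.-1) :
    \sum_(u | wheel_rel (Some i) u) F (wheel_weight (Some i) u) =
    F 2 + \sum_(j | cycle_rel i j) F (cycle_weight i j).
  by rewrite big_option.
have hub : \sum_(u : option 'I_n.-1 | wheel_rel None u) wheel_weight None u = n.-1 * 2.
  by rewrite big_option /= sum_nat_const card_ord.
(* Red rim degrees are at most 6, so only [n = 4] needs a closer look. *)
have hub_rim (i : 'I_n.-1) :
    2 + \sum_(j | cycle_rel i j) cycle_weight i j <> n.-1 * 2.
  rewrite (sum_cycle_weight id) // /id val_ord_pred.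
  have := cycle_pattern_le2 n.-1 i.
  have := cycle_pattern_le2 n.-1 (if i == 0 :> nat then n.-1.-1 else i.-1).
  have [n5|n5] := ltnP 4 n; first by lia.
  (* The rim is a triangle with edge weights 2, 1, 0, so the red rim degrees are 4, 5, 3, while the
     hub has 6. *)
  have nE : n = 4 by lia.
  by subst n; case: i => -[|[|[|]]].
split=> [[x|] [y|] //=|[x|] [y|] //=|[x|] [y|] //= xy w0|[x|] [y|] //= xy w2].
- exact: cycle_weight_sym.
- exact: cycle_pattern_le2.
- rewrite !(rim id) => /addnI; exact: (sum_cycle_weight_neq (F := id)).
- by rewrite (rim id) hub.
- by apply/nesym; rewrite (rim id) hub.
(* Spokes have weight 2, so every blue edge lies on the rim; the equal spoke terms at its two ends
   cancel. *)
- rewrite !(rim (subn 2)) => /addnI.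
  by apply: (sum_cycle_weight_neq (F := subn 2)) => // a b; rewrite !inE; lia.
Qed.

(** Turns the exclusion of [K_2] into the condition [n != 2] on paths. *)
Lemma path2_complete2_iso (G : graph) :
  graph_iso G (path_graph 2) -> graph_iso G (complete_graph 2).
Proof.
case=> f f_bij f_adj; exists f => // x y; rewrite -f_adj /= /complete_rel /path_rel.
by case: (f x) (f y) => -[|[|//]] ? [[|[|//]] ?].
Qed.

Theorem theorem2 (G : graph) :
  [\/ (exists n : nat, 1 <= n /\ graph_iso G (path_graph n)) /\
        ~ graph_iso G (complete_graph 2),
      exists n : nat, 3 <= n /\ graph_iso G (cycle_graph n)
    | exists n : nat, 4 <= n /\ graph_iso G (wheel_graph n)] ->
  exists k : nat, is_lir (two_multigraph G) k /\ k <= 2.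
Proof.
move=> G_fam; apply: li_colorable_is_lir.
suff [w] : exists w, @li_weighting G w by apply: li_weighting_colorable.
case: G_fam => [[[n [_ iso]] notK2] | [n [n3 iso]] | [n [n4 iso]]].
- apply: (li_weighting_iso iso (path_li_weighting _)).
  by apply/eqP=> n2; apply/notK2/path2_complete2_iso; rewrite -n2.
- exact: li_weighting_iso iso (cycle_li_weighting n3).
- exact: li_weighting_iso iso (wheel_li_weighting n4).
Qed.
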